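(* Let $X$ be a (not necessarily separable) Banach space. Then \[ \operatorname{dens}\big(B_{\operatorname{Lip}_0(X)},w^*\big)\leq \operatorname{dens}\big(B_{X^*},w^*\big). \] In particular, $\operatorname{dens}\big(B_{\operatorname{Lip}_0(X)},w^*\big)\leq \operatorname{dens} X$.
   Context: $\operatorname{Lip}_0(X)$ is the Banach space of real-valued Lipschitz functions $f$ on $X$ with $f(0)=0$, normed by the best Lipschitz constant. For $x\in X$, $\delta(x)\in \operatorname{Lip}_0(X)^*$ is evaluation at $x$; $\mathcal F(X)=\overline{\operatorname{span}}\{\delta(x):x\in X\}\subset \operatorname{Lip}_0(X)^*$ is the Lipschitz-free space, and $\mathcal F(X)^*=\operatorname{Lip}_0(X)$ isometrically. The $w^*$ topology on $\operatorname{Lip}_0(X)$ is the one induced by the predual $\mathcal F(X)$. $B_Z$ denotes the closed unit ball of a Banach space $Z$; $\operatorname{dens}$ is the smallest cardinality of a dense subset. *)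

(* Defs.v *)
From HB Require Import structures.
From mathcomp Require Import all_boot all_order all_algebra.
From mathcomp Require Import all_classical all_reals all_analysis.

Set Implicit Arguments.
Unset Strict Implicit.
Unset Printing Implicit Defensive.

Import Order.TTheory GRing.Theory Num.Theory.
Import numFieldNormedType.Exports.

Local Open Scope classical_set_scope.
Local Open Scope card_scope.
Local Open Scope ring_scope.

Lemma exists_least_card (T : Type) (P : set (set T)) : P !=set0 ->
  exists2 D, P D & forall E, P E -> D #<= E.
Proof.
move=> [D0 PD0].
pose I := {D : set T | P D}.
pose Q (Y : set (I -> T)) :=
  (forall f i, Y f -> sval i (f i)) /\
  (forall f g i, Y f -> Y g -> f i = g i -> f = g).
have [F FQ Ftot|Y [[Yin Yinj] Ymax]] := @Zorn_bigcup _ Q.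
  split=> [f i [A FA Af]|f g i [A FA Af] [B FB Bg] fg].
    by have [+ _] := FQ _ FA; apply.
  have [AB|BA] := Ftot _ _ FA FB.
    by have [_ /(_ f g i)] := FQ _ FB; apply => //; exact: AB.
  by have [_ /(_ f g i)] := FQ _ FA; apply => //; exact: BA.
have [i iY] : exists i : I, forall t, sval i t -> exists2 f, Y f & f i = t.
  apply/not_existsP => noi.
  have /choice[h hP] (i : I) :
      exists t, sval i t /\ forall f, Y f -> f i <> t.
    have /existsNP[t /not_implyP[Dt nf]] := noi i.
    by exists t; split=> // f Yf ft; apply: nf; exists f.
  have nYh : ~ Y h by move=> /(hP (exist _ D0 PD0)).2; exact.
  apply: (Ymax (h |` Y)).
    by split=> [|/(_ h)]; [exact: subsetUr|move=> H; apply/nYh/H; left].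
  split=> [f i [->|Yf]|f g i [->|Yf] [->|Yg] fg //].
  - exact: (hP i).1.
  - exact: Yin.
  - by have := (hP i).2 _ Yg; rewrite fg.
  - by have := (hP i).2 _ Yf; rewrite fg.
  - exact: Yinj fg.
exists (sval i); first exact: (svalP i).
move=> E PE; pose j : I := exist _ E PE.
have /choice[g gP] (u : T) : exists t, forall f, Y f -> f j = u -> f i = t.
  have [[f [Yf <-]]|nf] := pselect (exists f, Y f /\ f j = u).
    by exists (f i) => f' Yf' /(Yinj _ _ _ Yf' Yf) ->.
  by exists u => f Yf fu; case: nf; exists f.
apply: card_le_trans (card_image_le g E).
apply: subset_card_le => t /iY[f Yf <-]; exists (f j); first exact: (Yin f j).
exact: esym (gP _ f Yf erefl).
Qed.

Definition dense_subset (T : topologicalType) (A D : set T) : Prop :=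
  D `<=` A /\ A `<=` closure D.

(* A cardinal is represented by a set having that cardinality, and cardinals
   are compared with #<= ; [dens A] is a dense subset of A of least
   cardinality, which exists by [densP]. *)
Definition dens (T : topologicalType) (A : set T) : set T :=
  get [set D | dense_subset A D /\ forall E, dense_subset A E -> D #<= E].

Lemma densP (T : topologicalType) (A : set T) :
  dense_subset A (dens A) /\ forall E, dense_subset A E -> dens A #<= E.
Proof.
have [|D AD DE] := @exists_least_card T (dense_subset A).
  by exists A; split=> //; exact: subset_closure.
exact: (@getPex _ [set D | dense_subset A D /\ _] (ex_intro _ D (conj AD DE))).
Qed.

Definition unit_ball (R : realType) (V : normedModType R) : set V :=
  [set v | `|v| <= 1].
Arguments unit_ball {R} V.

Definition linear_span (R : realType) (V : lmodType R) (A : set V) : set V :=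
  [set v | exists n (c : 'I_n -> R) (a : 'I_n -> V),
    (forall i, A (a i)) /\ v = \sum_(i < n) c i *: a i].

Section dual.
Variables (R : realType) (V : normedModType R).

Definition dual_pred : {pred V -> R} :=
  mem [set f : V -> R | scalar f /\ continuous f].

Lemma dual_submod_closed : submod_closed dual_pred.
Proof.
split=> [|a f g].
  rewrite inE; split=> [k x y|x] /=; first by rewrite /GRing.zero/= mulr0 addr0.
  exact: cst_continuous.
rewrite !inE => -[flin fc] [glin gc]; split=> [k x y|x].
  rewrite !fctE flin glin /GRing.scale/=.
  rewrite !mulrDr mulrCA -!addrA; congr (_ + _).
  by rewrite addrCA.
by apply: cvgD; [apply: cvgM; [exact: cvg_cst|exact: fc]|exact: gc].
Qed.

HB.instance Definition _ :=
  GRing.isSubmodClosed.Build R (V -> R) dual_pred dual_submod_closed.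

Record dual : Type := Dual { dual_val :> V -> R ; _ : dual_val \in dual_pred }.

HB.instance Definition _ := [isSub for dual_val].
HB.instance Definition _ := [Choice of dual by <:].
HB.instance Definition _ := [SubChoice_isSubLmodule of dual by <:].

Lemma dualP (f : dual) : scalar f /\ continuous f.
Proof. by have := valP f; rewrite inE. Qed.

HB.instance Definition _ (f : dual) :=
  GRing.isLinear.Build R V R *%R (dual_val f) (dualP f).1.

Definition dual_norm (f : dual) : R := sup [set `|f x| | x in unit_ball V].

Lemma dual_has_sup (f : dual) : has_sup [set `|f x| | x in unit_ball V].
Proof.
split; first by exists `|f 0|, 0 => //; rewrite /unit_ball/= normr0.
pose g := [the {linear V -> R^o} of (f : V -> R^o)].
have /(linear_boundedP g)/pinfty_ex_gt0[M M0 fM] : bounded_near g (nbhs 0).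
  exact: continuous_linear_bounded ((dualP f).2 0).
exists M => _ [x xB <-]; apply: le_trans (fM x) _.
by rewrite -[leRHS]mulr1 ler_wpM2l// ltW.
Qed.

Lemma dual_norm_ub (f : dual) x : unit_ball V x -> `|f x| <= dual_norm f.
Proof. by move=> xB; apply: (ub_le_sup (dual_has_sup f).2); exists x. Qed.

Lemma dual_norm_le (f : dual) M :
  (forall x, unit_ball V x -> `|f x| <= M) -> dual_norm f <= M.
Proof.
move=> fM; apply: ge_sup; first exact: (dual_has_sup f).1.
by move=> _ [x xB <-]; exact: fM.
Qed.

Lemma dual_norm_bound (f : dual) x : `|f x| <= dual_norm f * `|x|.
Proof.
have [->|x0] := eqVneq x 0; first by rewrite linear0 !normr0 mulr0.
rewrite -ler_pdivrMr ?normr_gt0// -[in leLHS](normr_id x) -normf_div mulrC.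
rewrite -[X in `|X|](linearZ_LR f) dual_norm_ub// /unit_ball/=.
by rewrite normrZ normfV normr_id mulVf ?normr_eq0.
Qed.

Lemma dual_normD f g : dual_norm (f + g) <= dual_norm f + dual_norm g.
Proof.
apply: dual_norm_le => x xB; apply: le_trans (ler_normD _ _) _.
by rewrite lerD// dual_norm_ub.
Qed.

Lemma dual_normZ_le (a : R) f : dual_norm (a *: f) <= `|a| * dual_norm f.
Proof.
apply: dual_norm_le => x xB.
rewrite [X in `|X|](_ : _ = a * f x)// normrM.
by rewrite ler_wpM2l// dual_norm_ub.
Qed.

Lemma dual_normZ (a : R) f : dual_norm (a *: f) = `|a| * dual_norm f.
Proof.
apply/eqP; rewrite eq_le dual_normZ_le/=.
have [->|a0] := eqVneq a 0.
  rewrite normr0 mul0r; apply: le_trans (dual_norm_ub _ (_ : _ 0)) => //.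
  by rewrite /unit_ball/= normr0.
rewrite -ler_pdivlMl ?normr_gt0// -normfV.
by apply: le_trans (dual_normZ_le _ _); rewrite scalerA mulVf// scale1r.
Qed.

Lemma dual_norm0_eq0 f : dual_norm f = 0 -> f = 0.
Proof.
move=> f0; apply/val_inj/funext => x /=; apply/eqP; rewrite -normr_le0.
by have := dual_norm_bound f x; rewrite f0 mul0r.
Qed.

HB.instance Definition _ := @Lmodule_isNormed.Build R dual
  dual_norm dual_normD dual_normZ dual_norm0_eq0.

(* The topology of pointwise convergence on V, i.e. the one induced on the
   dual of V by its predual V. *)
Definition dual_wstar : topologicalType :=
  @sup_topology dual V (fun x => Topological.on
    (initial_topology (fun f : dual => (f x : R)))).

End dual.

Section lip0.
Variables (R : realType) (X : normedModType R).

Definition lip0_pred : {pred X -> R} :=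
  mem [set f : X -> R | f 0 = 0 /\ lipschitz f].

Lemma lip0_predP (f : X -> R) : f \in lip0_pred <->
  f 0 = 0 /\ exists2 k, 0 <= k & k.-lipschitz f.
Proof.
rewrite inE; split=> -[f0 fl]; split=> //; last first.
  case: fl => k _ fk; apply: klipschitzW fk.
  exact: (globally_properfilter (a := (0, 0))).
by have [k k0 fk] := pinfty_ex_gt0 fl; exists k => //; exact: ltW.
Qed.

Lemma lip0_submod_closed : submod_closed lip0_pred.
Proof.
split=> [|a f g].
  apply/lip0_predP; split=> //; exists 0 => // -[x y] _ /=.
  by rewrite subrr normr0 mul0r.
move=> /lip0_predP[f0 [k k0 fk]] /lip0_predP[g0 [l l0 gl]].
apply/lip0_predP; split.
  by rewrite !fctE f0 g0 scaler0 addr0.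
exists (`|a| * k + l); first by rewrite addr_ge0// mulr_ge0.
move=> [x y] _ /=; rewrite !fctE opprD addrACA -scalerBr.
apply: le_trans (ler_normD _ _) _; rewrite mulrDl lerD//.
  by rewrite normrM -mulrA ler_wpM2l//; exact: (fk (x, y)).
exact: (gl (x, y)).
Qed.

HB.instance Definition _ :=
  GRing.isSubmodClosed.Build R (X -> R) lip0_pred lip0_submod_closed.

Record lip0 : Type := Lip0 { lip0_val :> X -> R ; _ : lip0_val \in lip0_pred }.

HB.instance Definition _ := [isSub for lip0_val].
HB.instance Definition _ := [Choice of lip0 by <:].
HB.instance Definition _ := [SubChoice_isSubLmodule of lip0 by <:].

Lemma lip0P (f : lip0) : f 0 = 0 /\ exists2 k, 0 <= k & k.-lipschitz f.
Proof. exact/lip0_predP/valP. Qed.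

(* Without [0 <= k], the set would be unbounded below when X is trivial. *)
Definition lip0_norm (f : lip0) : R := inf [set k | 0 <= k /\ k.-lipschitz f].

Lemma lip0_norm_le (f : lip0) k :
  0 <= k -> k.-lipschitz f -> lip0_norm f <= k.
Proof. by move=> k0 fk; apply: ge_inf => //; exists 0 => l []. Qed.

Lemma lip0_norm_ge0 (f : lip0) : 0 <= lip0_norm f.
Proof.
have [_ [k k0 fk]] := lip0P f.
by apply: lb_le_inf; [exists k|move=> l []].
Qed.

Lemma lip0_norm_lip (f : lip0) x y :
  `|f x - f y| <= lip0_norm f * `|x - y|.
Proof.
have [_ [k k0 fk]] := lip0P f.
have [->|xy] := eqVneq x y; first by rewrite !subrr !normr0 mulr0.
have xy0 : 0 < `|x - y| by rewrite normr_gt0 subr_eq0.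
rewrite -ler_pdivrMr//; apply: lb_le_inf; first by exists k.
by move=> l [_ fl]; rewrite ler_pdivrMr//; exact: (fl (x, y)).
Qed.

Lemma lip0_normD f g : lip0_norm (f + g) <= lip0_norm f + lip0_norm g.
Proof.
apply: lip0_norm_le => [|[x y] _ /=]; first by rewrite addr_ge0// lip0_norm_ge0.
rewrite !fctE opprD addrACA mulrDl.
by apply: le_trans (ler_normD _ _) _; rewrite lerD// lip0_norm_lip.
Qed.

Lemma lip0_normZ_le (a : R) f : lip0_norm (a *: f) <= `|a| * lip0_norm f.
Proof.
apply: lip0_norm_le => [|[x y] _ /=].
  by rewrite mulr_ge0// lip0_norm_ge0.
rewrite !fctE -scalerBr normrM -mulrA.
by rewrite ler_wpM2l// lip0_norm_lip.
Qed.

Lemma lip0_normZ (a : R) f : lip0_norm (a *: f) = `|a| * lip0_norm f.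
Proof.
apply/eqP; rewrite eq_le lip0_normZ_le/=.
have [->|a0] := eqVneq a 0; first by rewrite normr0 mul0r lip0_norm_ge0.
rewrite -ler_pdivlMl ?normr_gt0// -normfV.
by apply: le_trans (lip0_normZ_le _ _); rewrite scalerA mulVf// scale1r.
Qed.

Lemma lip0_norm0_eq0 f : lip0_norm f = 0 -> f = 0.
Proof.
move=> f0; apply/val_inj/funext => x /=; apply/eqP; rewrite -normr_le0.
by have := lip0_norm_lip f x 0; rewrite f0 mul0r (lip0P f).1 subr0.
Qed.

HB.instance Definition _ := @Lmodule_isNormed.Build R lip0
  lip0_norm lip0_normD lip0_normZ lip0_norm0_eq0.

Definition eval (x : X) : lip0 -> R := fun f => f x.

Lemma eval_dual (x : X) : eval x \in @dual_pred R lip0.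
Proof.
rewrite inE; have evlin : scalar (eval x) by move=> a f g.
split=> //.
pose h : lip0 -> R^o := eval x.
pose hl := GRing.isLinear.Build R lip0 R^o *:%R h evlin.
pose g : {linear lip0 -> R^o} := HB.pack h hl.
apply: (@bounded_linear_continuous R lip0 R^o g).
apply/linear_boundedP; exists `|x|; split=> // M xM f.
have := lip0_norm_lip f x 0; rewrite (lip0P f).1 !subr0 => /le_trans; apply.
by rewrite mulrC ler_wpM2r// ?lip0_norm_ge0// ltW.
Qed.

Definition delta (x : X) : dual lip0 := Dual (eval_dual x).

Definition lipfree : set (dual lip0) := closure (linear_span (range delta)).

(* The topology induced on Lip_0(X) by its predual [lipfree], through the
   pairing of f with phi given by phi f. *)
Definition lip0_wstar : topologicalType :=
  @sup_topology lip0 lipfree (fun phi => Topological.on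
    (initial_topology (fun f : lip0 => (val phi f : R)))).

End lip0.

Arguments dual {R} V.
Arguments dual_wstar {R} V.
Arguments lip0 {R} X.
Arguments lipfree {R} X.
Arguments lip0_wstar {R} X.

(* Main.v *)
(* On the unit ball of Lip_0(X) the w*-topology is pointwise convergence, since
   the evaluations span a dense subspace of the predual. Let D be w*-dense in
   the unit ball of X*. By Hahn-Banach, the functions phi + q with phi in D and
   q rational approximate any 1-Lipschitz f at any two given points. The
   1-Lipschitz functions form a lattice, so, as in the Stone-Weierstrass theorem,
   finite max-min combinations of the phi + q approximate f on finite sets, and
   subtracting their values at 0 brings them back to Lip_0(X). When X <> 0, the
   set D is infinite, so there are no more such combinations than elements of D.
   For the bound by dens X, let D be dense in X; for every finite system of
   constraints |g(d_i) - q_i| < r with d_i in D and q_i, r rational choose a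
   1-Lipschitz solution g, if there is one. *)
From HB Require Import structures.
Require Import Defs.
From mathcomp Require Import all_boot all_order all_algebra.
From mathcomp Require Import all_classical all_reals all_analysis.
From mathcomp Require Import lra.

Set Implicit Arguments.
Unset Strict Implicit.
Unset Printing Implicit Defensive.

Import Order.TTheory GRing.Theory Num.Theory.
Import numFieldNormedType.Exports.

Local Open Scope classical_set_scope.
Local Open Scope card_scope.
Local Open Scope ring_scope.

(** * Squares of infinite cardinals *)

(** Replaces a map between subtypes by a total function that is injective on [A]; [u0] is the junk
    value outside [A]. *)
Lemma card_le_injP T U (A : set T) (B : set U) (u0 : U) : A #<= B ->
  exists f : T -> U, (forall x, A x -> B (f x)) /\
    (forall x y, A x -> A y -> f x = f y -> x = y).
Proof.
move=> /card_leP[f].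
pose g x := if pselect (A x) is left Ax then val (f (SigSub (mem_set Ax))) else u0.
exists g; split=> [x Ax|x y Ax Ay]; rewrite /g.
  by case: pselect => // ?; exact: set_valP.
case: pselect => // Ax'; case: pselect => // Ay' /val_inj.
by move=> /inj; rewrite !in_setT => /(_ isT isT)/(congr1 val).
Qed.

Lemma inj_card_leTT T U (f : T -> U) : injective f -> [set: T] #<= [set: U].
Proof.
move=> finj; apply: card_le_trans (card_leT (range f)).
by rewrite (card_le_eqr (inj_card_eq _)) => // x y _ _; exact: finj.
Qed.

Section square.
Variable T : Type.

(* Zorn's lemma is applied to the graphs [G] of injections from
   [dom G * dom G] to [dom G]. *)
Let dom (G : set (T * T * T)) : set T := [set a | exists c, G (a, a, c)].

(** Reading the carrier off the diagonal lets the graph alone carry all the data, so extending a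
    pairing is plain inclusion, as Zorn's lemma for unions requires. *)
Let pairing (G : set (T * T * T)) : Prop :=
  [/\ forall p c c', G (p, c) -> G (p, c') -> c = c',
      forall p p' c, G (p, c) -> G (p', c) -> p = p',
      forall a b, dom G a -> dom G b -> exists c, G (a, b, c) &
      forall a b c, G (a, b, c) -> [/\ dom G a, dom G b & dom G c]].

Let dom_subset G H : G `<=` H -> dom G `<=` dom H.
Proof. by move=> GH a [c Gc]; exists c; exact: GH. Qed.

(** Each clause involves at most two triples, and these lie in a common member of the chain. *)
Let pairing_bigcup (F : set (set (T * T * T))) :
  F `<=` pairing -> total_on F subset -> pairing (\bigcup_(G in F) G).
Proof.
move=> FP Ftot.
have two G H : F G -> F H -> exists K, [/\ F K, G `<=` K & H `<=` K].
  by move=> FG FH; have [GH|HG] := Ftot _ _ FG FH; [exists H|exists G]; split.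
split.
- move=> p c c' [G FG Gc] [H FH Hc']; have [K [FK GK HK]] := two _ _ FG FH.
  by have [Kfun _ _ _] := FP _ FK; apply: (Kfun p); [exact: GK|exact: HK].
- move=> p p' c [G FG Gc] [H FH Hc']; have [K [FK GK HK]] := two _ _ FG FH.
  by have [_ Kinj _ _] := FP _ FK; apply: (Kinj _ _ c); [exact: GK|exact: HK].
- move=> a b [c [G FG Gc]] [c' [H FH Hc']].
  have [K [FK GK HK]] := two _ _ FG FH.
  have [_ _ + _] := FP _ FK => /(_ a b)[| |d Kd]; last by exists d, K.
    by exists c; exact: GK.
  by exists c'; exact: HK.
- move=> a b c [G FG Gc]; have [_ _ _ /(_ _ _ _ Gc)[da db dc]] := FP _ FG.
  by split; apply: dom_subset (bigcup_sup FG) _ _.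
Qed.

(** A pairing on a countable subset, the seed that keeps a maximal graph from being empty. *)
Let pairing_nat (i : nat -> T) : injective i ->
  pairing [set q | exists m n, q = (i m, i n, i (pickle (m, n)))].
Proof.
move=> iinj.
have di k :
    dom [set q | exists m n, q = (i m, i n, i (pickle (m, n)))] (i k).
  by exists (i (pickle (k, k))), k, k.
split.
- by move=> p c c' [m [n [-> ->]]] [m' [n' [/iinj-> /iinj-> ->]]].
- move=> p p' c [m [n [-> ->]]] [m' [n' [-> /iinj]]].
  by move=> /(pcan_inj pickleK)[-> ->].
- move=> a b [_ [m [_ [-> _ _]]]] [_ [n [_ [-> _ _]]]].
  by exists (i (pickle (m, n))), m, n.
- by move=> a b c [m [n [-> -> ->]]].
Qed.

(* Take a maximal [G] with [dom G] infinite. If [dom G] injected into its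
   complement, [G] could be extended; otherwise [T] injects into [dom G]. *)
Lemma infinite_square_inj : infinite_set [set: T] ->
  exists f : T * T -> T, injective f.
Proof.
move=> Tinf.
have [t0 _] := infinite_setN0 Tinf.
have [i iinj] : exists i : nat -> T, injective i.
  have /infiniteP/(card_le_injP t0)[i [_ iinj]] := Tinf.
  by exists i => m n; exact: iinj.
pose Q G := pairing G /\ (G !=set0 -> infinite_set (dom G)).
have [|G [[[Gfun Ginj Gtot Gdom] Ginf] Gmax]] := @Zorn_bigcup _ Q.
  move=> F FQ Ftot; split; first by apply: pairing_bigcup => // G /FQ[].
  move=> [q [G FG Gq]]; have [_ Ginf] := FQ _ FG.
  apply: sub_infinite_set (Ginf _); last by exists q.
  exact: dom_subset (bigcup_sup FG).
have {}Ginf : infinite_set (dom G).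
  apply: Ginf; apply/set0P/eqP => G0.
  pose H := [set q | exists m n, q = (i m, i n, i (pickle (m, n)))].
  apply: (Gmax H).
    rewrite G0; split=> // /(_ (i 0%N, i 0%N, i (pickle (0%N, 0%N)))) [].
    by exists 0%N, 0%N.
  split=> [|_]; first exact: pairing_nat.
  have : infinite_set [set: nat] by exact: infinite_nat.
  apply: contra_not => domfin.
  have ri : range i `<=` dom H by move=> _ [k _ <-]; exists (i (pickle (k, k))), k, k.
  have := sub_finite_set ri domfin; rewrite (eq_finite_set (inj_card_eq _)) //.
  by move=> x y _ _; exact: iinj.
have /choice[f fP] (p : T * T) :
    exists c, dom G p.1 -> dom G p.2 -> G (p, c).
  case: p => a b /=; have [[/Gtot/[apply] -[c Gc]]|nd] :=
    pselect (dom G a /\ dom G b); first by exists c.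
  by exists a => da db; case: nd.
have fdom p : dom G p.1 -> dom G p.2 -> dom G (f p).
  by move=> d1 d2; have := fP p d1 d2; case: (p) => a b /Gdom[].
have finj p p' : dom G p.1 -> dom G p.2 -> dom G p'.1 -> dom G p'.2 ->
    f p = f p' -> p = p'.
  by move=> d1 d2 d1' d2' e; apply: (Ginj _ _ (f p)); [|rewrite e]; exact: fP.
have [a0 da0] := infinite_setN0 Ginf.
have [a1 [da1 a01]] : exists a1, dom G a1 /\ a1 <> a0.
  apply: contrapT => na; apply: Ginf; apply: sub_finite_set (finite_set1 a0).
  by move=> a da /=; apply: contrapT => aa0; apply: na; exists a.
(* Two copies of [dom G] fit into [dom G]: pairing with the distinct tags [a0] and [a1] keeps the
   two pieces apart. *)
have glue (B C : set T) (g : T -> T) : (forall x, C x -> dom G x \/ B x) ->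
    (forall x, B x -> dom G (g x)) ->
    (forall x y, B x -> B y -> g x = g y -> x = y) ->
    exists e : T -> T, (forall x, C x -> dom G (e x)) /\
      (forall x y, C x -> C y -> e x = e y -> x = y).
  move=> CAB gB ginj.
  exists (fun x => if pselect (dom G x) then f (a0, x) else f (a1, g x)).
  split=> [x /CAB|x y /CAB + /CAB].
    case: pselect => dx // H; apply: fdom => //=.
    by case: H => // /gB.
  case: pselect => dx H; case: pselect => dy K.
  - by move=> /finj => /(_ da0 dx da0 dy)[].
  - case: K => // By /finj => /(_ da0 dx da1 (gB _ By))[] aa.
    by case: a01.
  - case: H => // Bx /finj => /(_ da1 (gB _ Bx) da0 dy)[] aa.
    by case: a01.
  - case: H => // Bx; case: K => // By.
    by move=> /finj => /(_ da1 (gB _ Bx) da1 (gB _ By))[]; exact: ginj.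
(* Comparability of [dom G] with its complement: one of the two has least cardinality. *)
have [A PA Amin] := @exists_least_card T [set dom G; ~` dom G]
  (ex_intro _ _ (or_introl erefl)).
have [/(card_le_injP t0)[g [gC ginj]]|/(card_le_injP t0)[g [gA ginj]]] :
    dom G #<= ~` dom G \/ ~` dom G #<= dom G.
  by case: PA Amin => -> Amin; [left; apply: Amin; right|right; apply: Amin; left].
- pose B := [set g a | a in dom G]; pose C := dom G `|` B.
  have /choice[h hP] x : exists y, B x -> dom G y /\ g y = x.
    have [[y dy <-]|nB] := pselect (B x); first by exists y.
    by exists x.
  have [e [eC einj]] : exists e : T -> T, (forall x, C x -> dom G (e x)) /\
      (forall x y, C x -> C y -> e x = e y -> x = y).
    apply: (glue B C h) => // [x /hP[]//|x y /hP[_ gx] /hP[_ gy] hxy].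
    by rewrite -gx -gy hxy.
  (* [B] is a copy of [dom G] in the complement. The new pairs are sent into [B], so their values
     never collide with those of [G]. *)
  pose H := [set q : T * T * T | [/\ C q.1.1, C q.1.2,
    ~ (dom G q.1.1 /\ dom G q.1.2) & q.2 = g (f (e q.1.1, e q.1.2))]].
  have domGH : dom (G `|` H) = C.
    apply/seteqP; split=> x.
      by move=> [c [/Gdom[dx _ _]|[]//]]; left.
    move=> Cx; have [[c Gc]|nd] := pselect (dom G x); first by exists c; left.
    by exists (g (f (e x, e x))); right; split=> //= -[].
  have fe x y : C x -> C y -> dom G (f (e x, e y)).
    by move=> Cx Cy; apply: fdom; exact: eC.
  have Hout p c : H (p, c) -> ~ dom G c.
    by move=> [/= ? ? _ ->]; apply: gC; exact: fe.
  exfalso; apply: (Gmax (G `|` H)).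
    (* The extension is strict: [g a0] belongs to its domain but not to [dom G]. *)
    split=> [x|GH]; first by left.
    have Cg : C (g a0) by right; exists a0.
    have /GH/Gdom[dga _ _] : (G `|` H) (g a0, g a0, g (f (e (g a0), e (g a0)))).
      by right; split=> //= -[] /(gC _ da0).
    exact: gC da0 dga.
  split; last first.
    by move=> _; rewrite domGH; apply: sub_infinite_set Ginf; left.
  split; rewrite ?domGH.
  - move=> [a b] c c' [Gc|Hc] [Gc'|Hc'].
    + exact: Gfun Gc Gc'.
    + by case: Hc' => _ _ [] /=; have [] := Gdom _ _ _ Gc.
    + by case: Hc => _ _ [] /=; have [] := Gdom _ _ _ Gc'.
    + by case: Hc => _ _ _ /= ->; case: Hc' => _ _ _ /= ->.
  - move=> [a b] [a' b'] c [Gc|Hc] [Gc'|Hc'].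
    + exact: Ginj Gc Gc'.
    + by have [_ _ dc] := Gdom _ _ _ Gc; case: (Hout _ _ Hc').
    + by have [_ _ dc] := Gdom _ _ _ Gc'; case: (Hout _ _ Hc).
    + case: Hc Hc' => /= Ca Cb _ -> [/= Ca' Cb' _].
      move/ginj => /(_ (fe _ _ Ca Cb) (fe _ _ Ca' Cb')) /finj.
      move=> /(_ (eC _ Ca) (eC _ Cb) (eC _ Ca') (eC _ Cb'))[].
      by move=> /einj-/(_ Ca Ca')-> /einj-/(_ Cb Cb')->.
  - move=> a b Ca Cb; have [[/Gtot/[apply] -[c Gc]]|nd] :=
      pselect (dom G a /\ dom G b); first by exists c; left.
    by exists (g (f (e a, e b))); right.
  - move=> a b c [/Gdom[]|[/= Ca Cb _ ->]]; first by split; left.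
    by split=> //; right; exists (f (e a, e b)) => //; exact: fe.
(* Here all of [T] injects into [dom G], so the pairing [f] can be transported along [e]. *)
- have [e [eC einj]] : exists e : T -> T, (forall x, setT x -> dom G (e x)) /\
      (forall x y, setT x -> setT y -> e x = e y -> x = y).
    by apply: (glue (~` dom G) setT g) => // x _; exact: EM.
  exists (fun p => f (e p.1, e p.2)) => -[a b] [a' b'] /= /finj.
  by move=> /(_ (eC _ I) (eC _ I) (eC _ I) (eC _ I))[] /einj-> // /einj->.
Qed.

(** Lists are folded through the pairing; the length, stored alongside, tells the decoding where to
    stop. *)
Lemma infinite_seq_inj : infinite_set [set: T] ->
  exists f : seq T -> T, injective f.
Proof.
move=> Tinf; have [p pinj] := infinite_square_inj Tinf.
have [t0 _] := infinite_setN0 Tinf.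
have /infiniteP/(card_le_injP t0)[i [_ iinj]] := Tinf.
exists (fun s => p (i (size s), foldr (fun x y => p (x, y)) t0 s)).
move=> s s' /pinj[/iinj-/(_ I I)].
elim: s s' => [|x s IH] [|x' s']//= [sz] /pinj[-> e].
by rewrite (IH s').
Qed.

Lemma infinite_prod_count_inj (C : countType) : infinite_set [set: T] ->
  exists f : T * C -> T, injective f.
Proof.
move=> Tinf; have [p pinj] := infinite_square_inj Tinf.
have [t0 _] := infinite_setN0 Tinf.
have /infiniteP/(card_le_injP t0)[i [_ iinj]] := Tinf.
exists (fun q => p (q.1, i (pickle q.2))) => -[x c] [x' c'] /= /pinj[-> /iinj].
by move=> /(_ I I)/(pcan_inj pickleK)->.
Qed.

End square.

(** * Norming functionals *)

Section hahn_banach.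
Variables (R : realType) (V : lmodType R).
Implicit Types (q : V -> R) (x y : V).

(** Homogeneity is asked only as an inequality for positive factors, which is easy to check for
    infima; applying it to the inverse factor gives equality. *)
Definition sublinear q : Prop :=
  (forall x y, q (x + y) <= q x + q y) /\
  (forall (t : R) x, 0 < t -> q (t *: x) <= t * q x).

Lemma sublinear0 q : sublinear q -> q 0 = 0.
Proof.
(* The factor 2 gives [0 <= q 0], the factor 1/2 gives [q 0 <= 0]. *)
move=> [_ qZ]; have := qZ 2%:R 0 ltac:(lra); have := qZ (2%:R^-1) 0 ltac:(lra).
by rewrite !scaler0; lra.
Qed.

Lemma sublinearZ q t x : sublinear q -> 0 <= t -> q (t *: x) = t * q x.
Proof.
move=> qS; rewrite le0r => /orP[/eqP->|t0].
  by rewrite scale0r mul0r sublinear0.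
apply/eqP; rewrite eq_le qS.2//=.
have := qS.2 t^-1 (t *: x); rewrite invr_gt0 => /(_ t0).
by rewrite scalerA mulVf ?gt_eqF// scale1r ler_pdivlMl.
Qed.

Lemma sublinear_geN q x : sublinear q -> - q (- x) <= q x.
Proof.
by move=> qS; have := qS.1 x (- x); rewrite subrr sublinear0//; lra.
Qed.

Section infimum.
Variables (I : Type) (F : I -> V -> R) (i0 : I).
Hypothesis FD : forall i j, exists k, forall x y, F k (x + y) <= F i x + F j y.
Hypothesis FZ : forall i (t : R), 0 < t ->
  exists k, forall x, F k (t *: x) <= t * F i x.
Hypothesis Flb : forall x, exists m, forall i, m <= F i x.

Lemma inf_family_le i x : inf (range (F ^~ x)) <= F i x.
Proof.
by apply: ge_inf; [have [m mF] := Flb x; exists m => _ [j _ <-]|exists i].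
Qed.

Lemma le_inf_family m x : (forall i, m <= F i x) -> m <= inf (range (F ^~ x)).
Proof. by move=> mF; apply: lb_le_inf; [exists (F i0 x), i0|move=> _ [i _ <-]]. Qed.

(** The index [k] does not depend on the vectors, so both inequalities pass to the infimum. This
    serves for shifts and for lower bounds of chains. *)
Lemma inf_sublinear : sublinear (fun x => inf (range (F ^~ x))).
Proof.
split=> [x y|t x t0] /=.
  rewrite -lerBlDr; apply: (@le_inf_family _ x) => i.
  rewrite lerBlDr [leRHS]addrC -lerBlDr; apply: (@le_inf_family _ y) => j.
  have [k kF] := FD i j; rewrite lerBlDr [leRHS]addrC.
  exact: le_trans (inf_family_le k _) (kF _ _).
rewrite -ler_pdivrMl//; apply: le_inf_family => i; rewrite ler_pdivrMl//.
by have [k kF] := FZ i t0; exact: le_trans (inf_family_le k _) (kF _).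
Qed.

End infimum.

(* The shift is the infimum of [q (x + t *: y) - t * q y] over [t >= 0]. *)
Lemma sublinear_shift q y : sublinear q ->
  exists r, [/\ sublinear r, forall x, r x <= q x & forall x, r x <= q (x + y) - q y].
Proof.
move=> qS.
pose F (t : {t : R | 0 <= t}) x := q (x + sval t *: y) - sval t * q y.
pose t0 : {t : R | 0 <= t} := exist _ 0 (lexx 0).
pose t1 : {t : R | 0 <= t} := exist _ 1 ler01.
have Flb x : exists m, forall t, m <= F t x.
  (* By subadditivity, [t * q y = q (t *: y) <= q (x + t *: y) + q (- x)]. *)
  exists (- q (- x)) => -[t tge0]; rewrite /F/=.
  have := qS.1 (x + t *: y) (- x); rewrite addrAC subrr add0r sublinearZ//.
  by lra.
exists (fun x => inf (range (F ^~ x))); split=> [|x|x].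
- apply: inf_sublinear => //.
    move=> [s s0] [t t0']; exists (exist _ (s + t) (addr_ge0 s0 t0')) => x z.
    rewrite /F/= mulrDl scalerDl addrACA.
    by have := qS.1 (x + s *: y) (z + t *: y); lra.
  move=> [s s0] t tgt0; exists (exist _ (t * s) (mulr_ge0 (ltW tgt0) s0)) => x.
  by rewrite /F/= -scalerA -scalerDr sublinearZ ?(ltW tgt0)// mulrBr mulrA.
- apply: le_trans (inf_family_le Flb t0 x) _.
  by rewrite /F/= scale0r mul0r subr0 addr0.
- apply: le_trans (inf_family_le Flb t1 x) _.
  by rewrite /F/= scale1r mul1r.
Qed.

(** Zorn's lemma for the reversed pointwise order. A nonempty chain has its pointwise infimum as
    lower bound, finite because [- p (- x)] bounds it from below; for the empty chain [p] serves. *)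
Lemma exists_minimal_sublinear p : sublinear p -> exists q,
  [/\ sublinear q, forall x, q x <= p x &
      forall r, sublinear r -> (forall x, r x <= q x) -> r = q].
Proof.
move=> pS.
pose T := {q : V -> R | sublinear q /\ forall x, q x <= p x}.
pose le (q r : T) := `[< forall x, sval r x <= sval q x >].
have [||||q qmax] := @Zorn T le.
- by move=> q; apply/asboolP.
- move=> q r s /asboolP rq /asboolP sr; apply/asboolP => x.
  exact: le_trans (sr x) (rq x).
- move=> [q Pq] [r Pr] /asboolP/= rq /asboolP/= qr; apply: eq_exist.
  by apply/funext => x; apply/eqP; rewrite eq_le qr rq.
- move=> A Atot.
  have [[q0 Aq0]|A0] := pselect (A !=set0); last first.
    by exists (exist _ p (conj pS (fun=> lexx _))) => q Aq; case: A0; exists q.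
  pose F (q : {q : T | A q}) := sval (sval q).
  have Flb x : exists m, forall r, m <= F r x.
    exists (- p (- x)) => -[[q [qS qp]] Aq]; rewrite /F/=.
    by apply: le_trans (sublinear_geN _ qS); rewrite lerN2.
  pose i0 : {q : T | A q} := exist _ q0 Aq0.
  have infS : sublinear (fun x => inf (range (F ^~ x))).
    apply: inf_sublinear => //.
      move=> [q Aq] [r Ar].
      have [/asboolP h|/asboolP h] := Atot _ _ Aq Ar.
        exists (exist _ r Ar) => x y; rewrite /F/=.
        by apply: le_trans ((svalP r).1.1 x y) _; rewrite lerD2r.
      exists (exist _ q Aq) => x y; rewrite /F/=.
      by apply: le_trans ((svalP q).1.1 x y) _; rewrite lerD2l.
    move=> [q Aq] t t0; exists (exist _ q Aq) => x.
    exact: (svalP q).1.2.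
  have infp x : inf (range (F ^~ x)) <= p x.
    by apply: le_trans (inf_family_le Flb i0 x) _; exact: (svalP q0).2.
  exists (exist _ (fun x => inf (range (F ^~ x))) (conj infS infp)) => q Aq.
  apply/asboolP => x /=.
  exact: (inf_family_le Flb (exist _ q Aq) x).
exists (sval q); split; [exact: (svalP q).1|exact: (svalP q).2|].
move=> r rS rq.
have rp x : r x <= p x by apply: le_trans (rq x) _; exact: (svalP q).2.
by rewrite -(qmax (exist _ r (conj rS rp)))//; apply/asboolP.
Qed.

(* By minimality [q] coincides with its shifts, which makes it superadditive. *)
Lemma minimal_sublinear_scalar q : sublinear q ->
  (forall r, sublinear r -> (forall x, r x <= q x) -> r = q) -> scalar q.
Proof.
move=> qS qmin.
have qD x y : q (x + y) = q x + q y.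
  apply/eqP; rewrite eq_le qS.1/=.
  have [r [rS rq rqy]] := sublinear_shift y qS.
  by rewrite -lerBrDr -[in leLHS](qmin r rS rq).
have qN x : q (- x) = - q x.
  by have := qD x (- x); rewrite subrr sublinear0//; lra.
move=> a x y; rewrite qD; congr (_ + _).
have [a0|a0] := leP 0 a; first by rewrite sublinearZ.
by rewrite -[a]opprK scaleNr qN sublinearZ ?oppr_ge0 ?(ltW a0)// !mulNr.
Qed.

End hahn_banach.

(** A minimal sublinear functional below the shift of the norm by [v] is linear. At [- v] the shift
    is at most minus the norm of [v], which forces the value at [v]. *)
Lemma norming_functional (R : realType) (V : normedModType R) (v : V) :
  exists2 f : dual V, unit_ball (dual V) f & f v = `|v|.
Proof.
have nS : sublinear (fun x : V => `|x|).
  split=> [x y|t x t0]; first exact: ler_normD.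
  by rewrite normrZ gtr0_norm.
have [p [pS pn pv]] := sublinear_shift v nS.
have [q [qS qp qmin]] := exists_minimal_sublinear pS.
have qlin := minimal_sublinear_scalar qS qmin.
have qN x : q (- x) = - q x.
  by have := qlin (-1) x 0; rewrite scaleN1r !addr0 sublinear0// addr0 mulN1r.
have qle x : `|q x| <= `|x|.
  rewrite ler_norml (le_trans (qp x) (pn x)) andbT.
  by rewrite lerNl -qN -(normrN x) (le_trans (qp _) (pn _)).
have qc : continuous q.
  pose h : V -> R^o := q.
  pose hl := GRing.isLinear.Build R V R^o *:%R h qlin.
  pose g : {linear V -> R^o} := HB.pack h hl.
  apply: (@bounded_linear_continuous R V R^o g).
  apply/linear_boundedP; exists 1; split=> // M M1 x.
  by apply: le_trans (qle x) _; rewrite ler_peMl// ltW.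
have qd : q \in @dual_pred R V by rewrite inE.
exists (Dual qd).
  by apply: dual_norm_le => x; apply: le_trans; exact: qle.
apply/eqP; rewrite eq_le /= (le_trans (ler_norm _) (qle v))//=.
have := le_trans (qp (- v)) (pv (- v)).
by rewrite qN addNr normr0; lra.
Qed.

(** * Pointwise approximation in Lip_0(X) *)

Section lip_density.
Variables (R : realType) (X : normedModType R).
Implicit Types (f g : lip0 X) (phi psi : dual (lip0 X)).

Lemma unit_ball_lipP f :
  unit_ball (lip0 X) f <-> forall x y, `|f x - f y| <= `|x - y|.
Proof.
split=> [f1 x y|fl]; last first.
  by apply: lip0_norm_le => // -[x y] _ /=; rewrite mul1r.
apply: le_trans (lip0_norm_lip f x y) _.
by rewrite -[leRHS]mul1r ler_wpM2r.
Qed.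

Lemma linear_span_deltaE psi : linear_span (range (@delta R X)) psi ->
  exists n (c : 'I_n -> R) (y : 'I_n -> X),
    forall f, psi f = \sum_(i < n) c i * f (y i).
Proof.
move=> [n [c [a [aD ->]]]].
have /choice[y yP] i : exists x, delta x = a i by have [x _ <-] := aD i; exists x.
exists n, c, y => f; elim/big_rec2 : _ => // i u v _ <-.
by rewrite -yP.
Qed.

(** Distance in the norm of the bidual side is a uniform error on the unit ball of [lip0 X]. *)
Lemma lipfree_near phi (e : R) : lipfree X phi -> 0 < e ->
  exists n (c : 'I_n -> R) (y : 'I_n -> X), forall f, unit_ball (lip0 X) f ->
    `|phi f - \sum_(i < n) c i * f (y i)| < e.
Proof.
move=> phiF e0; have /phiF[psi [/linear_span_deltaE[n [c [y psiE]]]]] :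
  nbhs phi (ball phi e) by exact: nbhsx_ballx.
rewrite -ball_normE /= => phipsi; exists n, c, y => f f1.
rewrite -psiE; apply: le_lt_trans phipsi.
have -> : phi f - psi f = (phi - psi) f by [].
exact: dual_norm_ub.
Qed.

(** Reduces w*-density to approximation on finite subsets of [X]: on the unit ball, each element of
    the predual is uniformly close to a finite combination of evaluations. *)
Lemma lip_wstar_dense (E : set (lip0 X)) : E `<=` unit_ball (lip0 X) ->
  (forall f (s : seq X) (e : R), unit_ball (lip0 X) f -> 0 < e ->
    exists2 g, E g & forall x, x \in s -> `|g x - f x| < e) ->
  dense_subset (unit_ball (lip0 X) : set (lip0_wstar X)) E.
Proof.
move=> EB Eapprox; split=> // f f1 U Uf.
(* The sets [N p] generate a filter living on [E]; once it converges to [f], every w*-neighbourhood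
   of [f] meets [E]. *)
pose N (p : seq X * R) := [set g | E g /\ forall x, x \in p.1 -> `|g x - f x| < p.2].
pose F := filter_from [set p : seq X * R | 0 < p.2] N.
have FF : ProperFilter F.
  apply: filter_from_proper => [|[s e] e0]; last first.
    by have [g Eg gf] := Eapprox f s e f1 e0; exists g.
  apply: filter_from_filter; first by exists ([::], 1) => /=.
  move=> [s e] [t d] /= e0 d0; exists (s ++ t, Num.min e d).
    by rewrite /= lt_min e0.
  move=> g [/= Eg gst]; split; split=> // x xs /=.
    by have := gst x; rewrite mem_cat xs lt_min => /(_ isT)/andP[].
  by have := gst x; rewrite mem_cat xs orbT lt_min => /(_ isT)/andP[].
have FE : F E by exists ([::], 1) => //= g [].
suff FU : F --> (f : lip0_wstar X).
  have FEU : F (E `&` U) by apply: filterI => //; exact: FU.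
  by have [g EUg] := filter_ex FEU; exists g.
apply/cvg_sup => -[phi phiF] W.
rewrite nbhsE => -[B [[C Copen <-] /= Cf] BW].
have /nbhs_ballP[e /= e0 eC] : nbhs (phi f : R) C by exact: open_nbhs_nbhs.
have e3 : 0 < e / 3%:R by lra.
have [n [c [y phinear]]] := lipfree_near (set_mem phiF) e3.
(* An error [e / 3 / M] at the points [y i] costs at most [e / 3] in the combination; the summand 1
   keeps [M] positive. *)
pose M := 1 + \sum_(i < n) `|c i|.
have M0 : 0 < M by rewrite ltr_wpDr// sumr_ge0.
exists ([seq y i | i <- enum 'I_n], e / 3%:R / M); first by rewrite /= divr_gt0.
move=> g [/= Eg gf]; apply: BW; apply: eC; rewrite -ball_normE /=.
have sumle : `|\sum_(i < n) c i * f (y i) - \sum_(i < n) c i * g (y i)| <= e / 3%:R.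
  rewrite -sumrB; apply: le_trans (ler_norm_sum _ _ _) _.
  apply: (@le_trans _ _ (\sum_(i < n) `|c i| * (e / 3%:R / M))).
    apply: ler_sum => i _; rewrite -mulrBr normrM ler_wpM2l// distrC ltW//.
    by apply: gf; apply/mapP; exists i; rewrite // mem_enum.
  have SM : (\sum_(i < n) `|c i|) / M <= 1.
    by rewrite ler_pdivrMr// mul1r /M lerDr.
  by rewrite -mulr_suml mulrCA ler_piMr// ltW.
have := phinear f f1; have := phinear g (EB _ Eg); move: sumle.
set a := \sum_(i < n) _; set b := \sum_(i < n) _.
rewrite ler_norml !ltr_norml => /andP[? ?] /andP[? ?] /andP[? ?].
by apply/andP; split; lra.
Qed.

End lip_density.

(** * Max-min combinations of functions *)

Section maxmin.
Variables (R : realType) (X : eqType) (P : Type) (u : P -> X -> R).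

(** The default values truncate to the interval from [- n] to [n]. Being constants they do not spoil
    Lipschitz bounds, and they are harmless where the target is bounded by [n]. *)
Definition maxmin (n : nat) (s : seq (seq P)) (x : X) : R :=
  \big[Num.max/- n%:R]_(l <- s) \big[Num.min/n%:R]_(p <- l) u p x.

Lemma dist_maxr_le (a b a' b' c : R) : `|a - b| <= c -> `|a' - b'| <= c ->
  `|Num.max a a' - Num.max b b'| <= c.
Proof.
rewrite !ler_norml => /andP[? ?] /andP[? ?].
by have [?|?] := leP a a'; have [?|?] := leP b b'; apply/andP; split; lra.
Qed.

Lemma dist_minr_le (a b a' b' c : R) : `|a - b| <= c -> `|a' - b'| <= c ->
  `|Num.min a a' - Num.min b b'| <= c.
Proof.
rewrite !ler_norml => /andP[? ?] /andP[? ?].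
by have [?|?] := leP a a'; have [?|?] := leP b b'; apply/andP; split; lra.
Qed.

Lemma dist_maxmin_le n s x y c : 0 <= c ->
  (forall p, `|u p x - u p y| <= c) -> `|maxmin n s x - maxmin n s y| <= c.
Proof.
move=> c0 uc; rewrite /maxmin.
apply: (big_ind2 (fun a b => `|a - b| <= c)) => [|? ? ? ?|l _].
- by rewrite subrr normr0.
- exact: dist_maxr_le.
apply: (big_ind2 (fun a b => `|a - b| <= c)) => [|? ? ? ?|p _ //].
- by rewrite subrr normr0.
- exact: dist_minr_le.
Qed.

(* The lattice form of the Stone-Weierstrass argument. *)
Lemma maxmin_approx (f : X -> R) (w : X -> X -> P) (e : R) n (s : seq X) z :
  (forall x y, `|u (w x y) x - f x| < e /\ `|u (w x y) y - f y| < e) ->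
  `|f z| <= n%:R -> z \in s ->
  `|maxmin n [seq [seq w x y | y <- s] | x <- s] z - f z| <= e.
Proof.
move=> wf fn zs.
have e0 : 0 <= e by have [/(le_lt_trans (normr_ge0 _))/ltW] := wf z z.
move: fn; rewrite ler_norml => /andP[fn1 fn2].
rewrite /maxmin big_map ler_distl; apply/andP; split.
  (* Lower bound: in the row of [z] every entry is close to [f] at [z]. *)
  apply: (bigmax_sup_seq _ z) => //; rewrite big_map.
  apply: le_bigmin => [|y _]; first by lra.
  by have [+ _] := wf z y; rewrite ltr_distl => /andP[/ltW].
(* Upper bound: every row contains an entry [w x z], close to [f] at [z]. *)
apply: bigmax_le => [|x _]; first by lra.
rewrite big_map; apply: (bigmin_inf_seq _ z) => //.
by have [_ +] := wf x z; rewrite ltr_distl => /andP[_ /ltW].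
Qed.

End maxmin.

(** A finite [D] would have a finite, hence closed, image; this image would contain the whole
    interval from 0 to [b], in particular all [b / k.+1]. *)
Lemma infinite_of_approx (R : realType) (T : Type) (D : set T) (h : T -> R) (b : R) :
  0 < b -> (forall t e, 0 <= t <= b -> 0 < e -> exists2 d, D d & `|h d - t| < e) ->
  infinite_set D.
Proof.
move=> b0 happ Dfin.
have Scl : closed (h @` D).
  apply: (iffLR accessible_finite_set_closed);
    first exact/hausdorff_accessible/norm_hausdorff.
  exact: finite_image.
have sub : `[0, b]%classic `<=` h @` D.
  move=> t; rewrite /= in_itv /= => tb; apply: Scl => U /nbhs_ballP[e /= e0 eU].
  have [d Dd hd] := happ t e tb e0.
  by exists (h d); split; [exists d|apply: eU; rewrite -ball_normE /= distrC].
pose i (k : nat) : R := b / k.+1%:R.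
have ri : range i `<=` h @` D.
  move=> _ [k _ <-]; apply: sub; rewrite /= in_itv /= /i divr_ge0 ?(ltW b0)//=.
  by rewrite ler_pdivrMr// ler_peMr ?(ltW b0)// ler1n.
have := sub_finite_set ri (finite_image h Dfin).
rewrite (eq_finite_set (inj_card_eq _)); first exact: infinite_nat.
move=> k l _ _ /(mulfI (lt0r_neq0 b0))/invr_inj/eqP.
by rewrite eqr_nat eqSS => /eqP.
Qed.

Lemma rat_near (R : realType) (a e : R) : 0 < e -> exists q : rat, `|ratr q - a| < e.
Proof.
move=> e0; have [|q] := @rat_in_itvoo R (a - e) (a + e); first by lra.
by rewrite in_itv /= => qe; exists q; rewrite ltr_distl.
Qed.

Lemma dense_subset_neq0 (T : topologicalType) (A D : set T) :
  A !=set0 -> dense_subset A D -> D !=set0.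
Proof.
move=> [a Aa] [_ AD]; have [x []] := AD a Aa setT filterT.
by exists x.
Qed.

(** * Approximation by w*-dense sets of functionals *)

Section dual_density.
Variables (R : realType) (X : normedModType R) (D : set (dual X)).
Hypothesis Ddense : dense_subset (unit_ball (dual X) : set (dual_wstar X)) D.

Lemma dual_wstar_approx (phi : dual X) (z : X) (e : R) :
  unit_ball (dual X) phi -> 0 < e -> exists2 psi, D psi & `|psi z - phi z| < e.
Proof.
move=> phi1 e0.
have Uphi : nbhs (phi : dual_wstar X) [set psi : dual X | `|psi z - phi z| < e].
  have /cvg_sup/(_ z) cz : nbhs (phi : dual_wstar X) --> (phi : dual_wstar X).
    exact: cvg_id.
  apply: cz; apply: (@initial_continuous _ _ (fun f : dual X => f z : R) phi
    (fun r => `|r - phi z| < e)).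
  apply/nbhs_ballP; exists e => //= r; by rewrite -ball_normE /= distrC.
by have [psi []] := Ddense.2 phi phi1 _ Uphi; exists psi.
Qed.

(** A norming functional of [x - y], scaled by the slope [t] of [f], has the increment of [f]. An
    element of [D] nearly keeps it, and a rational constant adjusts the values. *)
Lemma dual_wstar_two_points (f : lip0 X) (x y : X) (e : R) :
  unit_ball (lip0 X) f -> 0 < e -> exists p : set_type D * rat,
    `|val p.1 x + ratr p.2 - f x| < e /\ `|val p.1 y + ratr p.2 - f y| < e.
Proof.
move=> /unit_ball_lipP fl e0.
have [phi phi1 phixy] := norming_functional (x - y).
(* For [x = y] the quotient is 0, and [txy] still holds. *)
pose t := (f x - f y) / `|x - y|.
have t1 : `|t| <= 1.
  rewrite normf_div normr_id; have [->|xy] := eqVneq x y.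
    by rewrite !subrr normr0 mul0r.
  by rewrite ler_pdivrMr ?mul1r// normr_gt0 subr_eq0.
have txy : t * `|x - y| = f x - f y.
  rewrite /t; have [->|xy] := eqVneq x y; first by rewrite !subrr !mul0r.
  by rewrite divfK// normr_eq0 subr_eq0.
have tphi1 : unit_ball (dual X) (t *: phi).
  by rewrite /unit_ball /= normrZ mulr_ile1.
have e2 : 0 < e / 2%:R by lra.
have [psi Dpsi] := dual_wstar_approx (x - y) tphi1 e2.
have -> : (t *: phi) (x - y) = f x - f y by rewrite -txy -phixy.
rewrite linearB /= ltr_norml => /andP[? ?].
have [q] := rat_near (f x - psi x) e2.
rewrite ltr_norml => /andP[? ?].
exists (SigSub (mem_set Dpsi), q); rewrite /= !ltr_norml.
by split; apply/andP; split; lra.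
Qed.

(** Multiples of a norming functional of [v] take at [v] every value between 0 and the norm of
    [v]. *)
Lemma dual_dense_infinite (v : X) : v != 0 -> infinite_set D.
Proof.
move=> v0; have nv : 0 < `|v| by rewrite normr_gt0.
apply: (infinite_of_approx (h := fun phi : dual X => phi v) nv).
move=> t e /andP[t0 tv] e0.
have [phi phi1 phiv] := norming_functional v.
have tphi1 : unit_ball (dual X) ((t / `|v|) *: phi).
  rewrite /unit_ball /= normrZ mulr_ile1//.
  by rewrite ger0_norm ?divr_ge0// ler_pdivrMr// mul1r.
have [psi Dpsi] := dual_wstar_approx v tphi1 e0.
have -> : ((t / `|v|) *: phi) v = t / `|v| * phi v by [].
by rewrite phiv divfK ?normr_eq0//; exists psi.
Qed.

End dual_density.

(** * Counting the approximating families *)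

Section lip_families.
Variables (R : realType) (X : normedModType R).

Lemma affine_maxmin_lip (D : set (dual X)) n s :
  D `<=` unit_ball (dual X) ->
  exists2 g : lip0 X, unit_ball (lip0 X) g &
    forall x,
      let h := maxmin (fun (p : set_type D * rat) x => val p.1 x + ratr p.2) n s in
      g x = h x - h 0.
Proof.
move=> D1; set h := maxmin _ n s.
have hl x y : `|h x - h y| <= `|x - y|.
  apply: dist_maxmin_le => // -[[phi Dphi] q] /=.
  rewrite opprD addrACA subrr addr0 -linearB.
  apply: le_trans (dual_norm_bound phi (x - y)) _.
  by rewrite -[leRHS]mul1r ler_wpM2r//; exact: (D1 _ (set_mem Dphi)).
have gl x y : `|(h x - h 0) - (h y - h 0)| <= `|x - y|.
  by rewrite opprB addrA subrK.
have gP : (fun x => h x - h 0) \in @lip0_pred R X.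
  apply/lip0_predP; split; first by rewrite subrr.
  by exists 1 => // -[x y] _ /=; rewrite mul1r.
by exists (Lip0 gP) => //; apply/unit_ball_lipP.
Qed.


Lemma dens_lip_le (T P : Type) (D : set T) (F : P -> lip0 X) (j : P -> set_type D) :
  dense_subset (unit_ball (lip0 X) : set (lip0_wstar X)) (range F) ->
  injective j ->
  dens (unit_ball (lip0 X) : set (lip0_wstar X)) #<= D.
Proof.
move=> Fdense jinj.
apply: card_le_trans ((densP _).2 _ Fdense) _.
apply: card_le_trans (card_image_le _ _) _.
apply: card_le_trans (inj_card_leTT jinj) _.
by have /card_eqPle[] := card_setT D.
Qed.

Lemma infinite_set_type (T : Type) (D : set T) :
  infinite_set D -> infinite_set [set: set_type D].
Proof. by rewrite (eq_finite_set (card_setT D)). Qed.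

Lemma dens_lip_le_dual (v : X) (D : set (dual X)) : v != 0 ->
  dense_subset (unit_ball (dual X) : set (dual_wstar X)) D ->
  dens (unit_ball (lip0 X) : set (lip0_wstar X)) #<= D.
Proof.
move=> v0 Ddense.
have Dinf := infinite_set_type (dual_dense_infinite Ddense v0).
have [a ainj] := infinite_prod_count_inj rat Dinf.
have [b binj] := infinite_seq_inj Dinf.
have [c cinj] := infinite_prod_count_inj nat Dinf.
(* [a] absorbs the rational constants, [b] codes both the inner and the outer lists, [c] adds the
   truncation level. *)
pose code (p : seq (seq (set_type D * rat)) * nat) :=
  c (b (map (b \o map a) p.1), p.2).
have codeinj : injective code.
  move=> [s n] [s' n'] /cinj[/binj + ->] => /inj_map -> //.
  by move=> l l' /= /binj/inj_map->.
have /choice[F FP] (p : seq (seq (set_type D * rat)) * nat) :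
    exists g : lip0 X, unit_ball (lip0 X) g /\ forall x,
      let h := maxmin (fun (p : set_type D * rat) x => val p.1 x + ratr p.2) p.2 p.1 in
      g x = h x - h 0.
  by have [g] := affine_maxmin_lip p.2 p.1 Ddense.1; exists g.
apply: (dens_lip_le (F := F) _ codeinj).
apply: lip_wstar_dense => [_ [p _ <-]|f s e f1 e0]; first by have [] := FP p.
have e3 : 0 < e / 3%:R by lra.
have /choice[w wP] (xy : X * X) := dual_wstar_two_points Ddense xy.1 xy.2 f1 e3.
(* The point 0 joins [s] because the approximant is corrected by its value there; the two errors
   [e / 3] add up to less than [e]. *)
have [n nP] : exists n, forall x, x \in 0 :: s -> `|f x| <= n%:R.
  elim: (0 :: s) => [|x t [n IH]]; first by exists 0%N.
  exists (maxn n (Num.truncn `|f x|).+1) => y; rewrite inE => /predU1P[->|yt].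
    by apply: le_trans (ltW (truncnS_gt _)) _; rewrite ler_nat leq_maxr.
  by apply: le_trans (IH y yt) _; rewrite ler_nat leq_maxl.
pose l := [seq [seq w (x, y) | y <- 0 :: s] | x <- 0 :: s].
exists (F (l, n)); first by exists (l, n).
move=> x xs; have [_ ->] := FP (l, n).
have approx z : z \in 0 :: s -> `|maxmin (fun (p : set_type D * rat) x =>
    val p.1 x + ratr p.2) n l z - f z| <= e / 3%:R.
  move=> zs; have wP' y y' := wP (y, y').
  exact: (maxmin_approx (w := fun x y => w (x, y)) wP' (nP z zs) zs).
have := approx x; rewrite inE xs orbT => /(_ isT).
have := approx 0; rewrite inE eqxx (lip0P f).1 => /(_ isT) /=.
rewrite !ler_norml => /andP[? ?] /andP[? ?]; rewrite ltr_norml.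
by apply/andP; split; lra.
Qed.

Lemma dense_infinite (v : X) (D : set X) : v != 0 ->
  dense_subset [set: X] D -> infinite_set D.
Proof.
move=> v0 Ddense; have nv : 0 < `|v| by rewrite normr_gt0.
apply: (infinite_of_approx (h := fun x : X => `|x|) nv).
move=> t e /andP[t0 tv] e0; pose x := (t / `|v|) *: v.
have [d [Dd]] := Ddense.2 x I _ (nbhsx_ballx x e e0).
rewrite -ball_normE /= => xd; exists d => //.
have -> : t = `|x|.
  by rewrite normrZ ger0_norm ?divr_ge0// divfK ?normr_eq0.
by apply: le_lt_trans xd; rewrite [leRHS]distrC; exact: ler_dist_dist.
Qed.

Lemma dens_lip_le_dens (v : X) (D : set X) : v != 0 ->
  dense_subset [set: X] D ->
  dens (unit_ball (lip0 X) : set (lip0_wstar X)) #<= D.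
Proof.
move=> v0 Ddense.
have Dinf := infinite_set_type (dense_infinite v0 Ddense).
have [a ainj] := infinite_prod_count_inj rat Dinf.
have [b binj] := infinite_seq_inj Dinf.
pose code (p : seq (set_type D * rat) * rat) := a (b (map a p.1), p.2).
have codeinj : injective code.
  by move=> [s n] [s' n'] /ainj[/binj + ->] => /inj_map ->.
pose good (p : seq (set_type D * rat) * rat) (g : lip0 X) :=
  unit_ball (lip0 X) g /\
  forall q, q \in p.1 -> `|g (val q.1) - ratr q.2| < ratr p.2.
(* Unsolvable systems get the default 0, so that [F] always stays in the unit ball. *)
have /choice[F FP] p : exists g : lip0 X,
    unit_ball (lip0 X) g /\ ((exists h, good p h) -> good p g).
  have [[h ph]|nh] := pselect (exists h, good p h); first by exists h; case: ph.
  by exists 0; split=> // ; rewrite /unit_ball /= normr0.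
apply: (dens_lip_le (F := F) _ codeinj).
apply: lip_wstar_dense => [_ [p _ <-]|f s e f1 e0]; first by have [] := FP p.
(* Passing from [F p x] to [f x] through the chosen point of [D] and the chosen rational makes four
   errors, each at most [ratr r]. *)
have [r re] : exists r : rat, 0 < (ratr r : R) < e / 4%:R.
  have [|r] := @rat_in_itvoo R 0 (e / 4%:R); first by lra.
  by rewrite in_itv /=; exists r.
move/andP: re => [r0 re].
have /choice[w wP] (x : X) : exists q : set_type D * rat,
    `|x - val q.1| < ratr r /\ `|ratr q.2 - f (val q.1)| < ratr r.
  have [d [Dd]] := Ddense.2 x I _ (nbhsx_ballx x (ratr r) r0).
  rewrite -ball_normE /= => xd; have [q qP] := rat_near (f d) r0.
  by exists (SigSub (mem_set Dd), q).
pose p := (map w s, r).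
(* The system [p] is solvable since [f] itself solves it. *)
have [Fp1 /(_ _)[|_ Fp]] := FP p.
  exists f; split=> // _ /mapP[x xs ->] /=.
  by rewrite distrC; have [] := wP x.
exists (F p); first by exists p.
move=> x xs; have [xw wf] := wP x.
have /= := Fp (w x) (map_f w xs).
have := (unit_ball_lipP f).1 f1 x (val (w x).1).
have := (unit_ball_lipP (F p)).1 Fp1 x (val (w x).1).
move: xw wf; set y := val (w x).1.
rewrite !ler_norml !ltr_norml => xw /andP[? ?] /andP[? ?] /andP[? ?] /andP[? ?].
by apply/andP; split; lra.
Qed.

(** Covers the zero space, where dense sets may be finite and the coding of lists fails; there
    [lip0 X] contains only 0. *)
Lemma dens_lip_trivial (T : Type) (B : set T) : (forall x : X, x = 0) ->
  B !=set0 -> dens (unit_ball (lip0 X) : set (lip0_wstar X)) #<= B.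
Proof.
move=> X0 [b Bb].
apply: (@card_le_trans _ _ _ [set (0 : lip0 X)]).
  apply: subset_card_le => f _ /=; apply/val_inj/funext => x /=.
  by rewrite (X0 x) (lip0P f).1.
apply: (@card_le_trans _ _ _ [set b]); last by apply: subset_card_le => _ ->.
by have /card_eqPle[] := eq_card1 (0 : lip0 X) b.
Qed.

End lip_families.

Theorem theorem12 (R : realType) (X : completeNormedModType R) :
  (dens (unit_ball (lip0 X) : set (lip0_wstar X)) #<=
     dens (unit_ball (dual X) : set (dual_wstar X)))
  /\
  (dens (unit_ball (lip0 X) : set (lip0_wstar X)) #<= dens [set: X]).
Proof.
have Bdense := (densP (unit_ball (dual X) : set (dual_wstar X))).1.
have Xdense := (densP [set: X]).1.
have [[v /eqP v0]|X0] := pselect (exists v : X, v <> 0).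
  by split; [exact: dens_lip_le_dual v0 _|exact: dens_lip_le_dens v0 _].
have {}X0 (x : X) : x = 0 by apply: contrapT => x0; apply: X0; exists x.
split; apply: dens_lip_trivial => //.
  by apply: dense_subset_neq0 Bdense; exists 0; rewrite /unit_ball /= normr0.
by apply: dense_subset_neq0 Xdense; exists 0.
Qed.
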